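(* Let $(X,\preceq)$ be a prefix order and let $\mu:\mathcal O_X\to[0,\infty]$ be a locally finite and Scott-continuous valuation on the Alexandroff topology $\mathcal O_X$ of $X$. Then the function $\tilde\mu:\mathcal S_{X^\infty}\to[0,\infty]$ defined by $\tilde\mu(V)=\mu(V\cap X)$ for every Scott-open $V\subseteq X^\infty$ is a Scott-continuous valuation. If moreover $X$ is simple, then $\tilde\mu$ is locally finite.
   Context: A prefix order is a partial order whose principal ideals are totally ordered; it is simple if every principal ideal is finite. $\mathcal O_X$: the Alexandroff topology (upward closed sets). Closed sets are downward closed; a closed set $C$ is irreducible if nonempty and not a union of two smaller closed sets; $C$ is non-sober if closed, irreducible and not equal to ${\downarrow}x$ for any $x\in X$. $X^\infty=X\cup\{\infty_C\mid C\text{ non-sober}\}$ with order $\preceq'={\preceq}\cup\{(\infty_C,\infty_C)\}\cup\{(x,\infty_C)\mid x\in C\}$. $\mathcal S_{X^\infty}$ is the set of Scott-open subsets of $X^\infty$: upward closed sets $U$ such that any directed $D$ whose supremum exists and lies in $U$ meets $U$. A valuation on a topology $\mathcal O$ is $\mu:\mathcal O\to[0,\infty]$ with $\mu(\emptyset)=0$, monotone, and modular: $\mu(U)+\mu(U')=\mu(U\cup U')+\mu(U\cap U')$. It is Scott-continuous if $\mu(\bigcup_i U_i)=\sup_i\mu(U_i)$ for every directed family of open sets, and locally finite if every point has an open neighbourhood of finite value. *)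

(* Defs.v *)
From HB Require Import structures.
From mathcomp Require Import all_boot all_order all_algebra.
From mathcomp Require Import all_classical all_reals all_analysis.

Set Implicit Arguments.
Unset Strict Implicit.
Unset Printing Implicit Defensive.

Local Open Scope classical_set_scope.

Definition principal_ideal d (X : porderType d) (x : X) : set X :=
  [set y | (y <= x)%O].

Definition prefix_order d (X : porderType d) : Prop :=
  forall x : X, total_on (principal_ideal x) <=%O.

Definition simple_prefix_order d (X : porderType d) : Prop :=
  forall x : X, finite_set (principal_ideal x).

Definition upward_closed d (X : porderType d) (U : set X) : Prop :=
  forall x y : X, U x -> (x <= y)%O -> U y.

(* Directed sets are nonempty by convention. *)
Definition directed (T : Type) (r : T -> T -> Prop) (D : set T) : Prop :=
  D !=set0 /\
  forall x y, D x -> D y -> exists z, [/\ D z, r x z & r y z].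

(* Alias of X carrying the topology whose open sets are the upward closed ones;
   X itself is kept free of any topology. *)
Definition alexandroff d (X : porderType d) : Type := X.

Section AlexandroffTopology.
Context d (X : porderType d).

HB.instance Definition _ := Choice.on (alexandroff X).

Lemma upward_closed_setT : upward_closed [set: X].
Proof. by []. Qed.

Lemma upward_closed_setI (A B : set X) :
  upward_closed A -> upward_closed B -> upward_closed (A `&` B).
Proof. by move=> uA uB x y [Ax Bx] xy; split; [exact: uA xy|exact: uB xy]. Qed.

Lemma upward_closed_bigcup (I : Type) (F : I -> set X) :
  (forall i, upward_closed (F i)) -> upward_closed (\bigcup_i F i).
Proof. by move=> uF x y [i _ Fix] xy; exists i => //; exact: uF xy. Qed.

HB.instance Definition _ :=
  isOpenTopological.Build (alexandroff X)
    upward_closed_setT upward_closed_setI upward_closed_bigcup.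

Lemma open_alexandroffE (U : set (alexandroff X)) : open U = upward_closed (U : set X).
Proof. by []. Qed.

End AlexandroffTopology.

Definition scott_open d (X : porderType d) (U : set X) : Prop :=
  upward_closed U /\
  forall (D : set X) (s : X), directed <=%O D -> supremums D s -> U s ->
    D `&` U !=set0.

Definition scott d (X : porderType d) : Type := X.

Section ScottTopology.
Context d (X : porderType d).

HB.instance Definition _ := Choice.on (scott X).

Lemma scott_open_setT : scott_open [set: X].
Proof. by split=> // D s [[x Dx] _] _ _; exists x. Qed.

Lemma scott_open_setI (A B : set X) : scott_open A -> scott_open B -> scott_open (A `&` B).
Proof.
move=> [uA sA] [uB sB]; split.
  by move=> x y [Ax Bx] xy; split; [exact: uA xy|exact: uB xy].
move=> D s dD Ds [As Bs].
have [a [Da Aa]] := sA D s dD Ds As.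
have [b [Db Bb]] := sB D s dD Ds Bs.
have [c [Dc ac bc]] := dD.2 a b Da Db.
by exists c; split=> //; split; [exact: uA ac|exact: uB bc].
Qed.

Lemma scott_open_bigcup (I : Type) (F : I -> set X) :
  (forall i, scott_open (F i)) -> scott_open (\bigcup_i F i).
Proof.
move=> oF; split.
  by move=> x y [i _ Fix] xy; exists i => //; exact: (oF i).1 xy.
move=> D s dD Ds [i _ Fis].
have [x [Dx Fix]] := (oF i).2 D s dD Ds Fis.
by exists x; split=> //; exists i.
Qed.

HB.instance Definition _ :=
  isOpenTopological.Build (scott X)
    scott_open_setT scott_open_setI scott_open_bigcup.

Lemma open_scottE (U : set (scott X)) : open U = scott_open (U : set X).
Proof. by []. Qed.

End ScottTopology.

Definition irreducible (T : topologicalType) (C : set T) : Prop :=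
  C !=set0 /\
  ~ exists A B : set T,
      [/\ closed A, closed B, A `<` C, B `<` C & C = A `|` B].

Definition non_sober d (X : porderType d) (C : set (alexandroff X)) : Prop :=
  [/\ closed C, irreducible C & forall x : X, C <> principal_ideal x].

(* The poset obtained by adding to X a point at infinity above each non-sober
   closed set; distinct points at infinity are incomparable. *)
Inductive Xinfty d (X : porderType d) : Type :=
| Base of X
| Infty (C : set (alexandroff X)) of non_sober C.

Arguments Base {d X} x.
Arguments Infty {d X} C _.

Section XinftyOrder.
Context d (X : porderType d).

HB.instance Definition _ := gen_eqMixin (Xinfty X).
HB.instance Definition _ := gen_choiceMixin (Xinfty X).

Definition le_Xinfty (p q : Xinfty X) : bool :=
  match p, q with
  | Base x, Base y => (x <= y)%O
  | Base x, Infty C _ => `[< C x >]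
  | Infty C _, Infty C' _ => `[< C = C' >]
  | Infty _ _, Base _ => false
  end.

Lemma le_Xinfty_refl : reflexive le_Xinfty.
Proof. by move=> [x|C ?] /=; [exact: Order.POrderTheory.lexx|exact/asboolP]. Qed.

Lemma le_Xinfty_anti : antisymmetric le_Xinfty.
Proof.
move=> [x|C nC] [y|C' nC'] //=; rewrite ?andbF //.
  by move=> /Order.POrderTheory.le_anti ->.
move=> /andP[/asboolP CC' _]; subst C'.
by rewrite (Prop_irrelevance nC nC').
Qed.

Lemma closed_alexandroff (C : set (alexandroff X)) (x y : X) :
  closed C -> (x <= y)%O -> C y -> C x.
Proof.
rewrite -openC => oC xy Cy; apply: contrapT => nCx.
by have := oC x y nCx xy; apply.
Qed.

Lemma le_Xinfty_trans : transitive le_Xinfty.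
Proof.
move=> [y|C nC] [x|C' nC'] [z|C'' nC''] //=.
- exact: Order.POrderTheory.le_trans.
- move=> xy /asboolP Cy; apply/asboolP.
  by case: nC'' => cC _ _; exact: closed_alexandroff cC xy Cy.
- by move=> /asboolP Cx /asboolP <-; exact/asboolP.
- by move=> /asboolP -> /asboolP ->; exact/asboolP.
Qed.

HB.instance Definition _ := Order.Le_isPOrder.Build d (Xinfty X)
  le_Xinfty_refl le_Xinfty_anti le_Xinfty_trans.

End XinftyOrder.

(* A valuation on a topology is represented by a function on all sets of
   points; only its values on open sets are meaningful. *)
Section Valuation.
Context (R : realType) (T : topologicalType).
Implicit Type mu : set T -> \bar R.
Local Open Scope ereal_scope.

Definition valuation mu : Prop :=
  [/\ forall U, open U -> 0 <= mu U,
      mu set0 = 0,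
      forall U V, open U -> open V -> U `<=` V -> mu U <= mu V &
      forall U V, open U -> open V ->
        mu U + mu V = mu (U `|` V) + mu (U `&` V)].

Definition scott_continuous mu : Prop :=
  forall F : set (set T), F `<=` open -> directed subset F ->
    mu (\bigcup_(U in F) U) = ereal_sup [set mu U | U in F].

Definition locally_finite mu : Prop :=
  forall x : T, exists U : set T, open_nbhs x U /\ mu U < +oo.

End Valuation.

Definition traceX d (X : porderType d) (V : set (scott (Xinfty X))) :
  set (alexandroff X) := Base @^-1` V.

(* This is why mu_tilde only evaluates mu on open sets when V is open. *)
Lemma open_traceX d (X : porderType d) (V : set (scott (Xinfty X))) :
  open V -> open (traceX V).
Proof.
rewrite open_scottE open_alexandroffE => -[uV _] x y Vx xy.
exact: (uV (Base x) (Base y) Vx xy).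
Qed.

Definition mu_tilde (R : realType) d (X : porderType d)
    (mu : set (alexandroff X) -> \bar R) :
  set (scott (Xinfty X)) -> \bar R := fun V => mu (traceX V).

(* Main.v *)
(** The trace map [V |-> V `&` X] preserves unions and intersections, so only
    local finiteness needs an argument. For it, the upper set in [Xinfty X] of a
    point [x] of [X] is Scott-open when [X] is simple. Points below a common
    point are comparable (for a point at infinity, because irreducible closed
    sets are chains), so a directed set whose supremum [s] is above [x], but
    which has no element above [x], lies below [x]; hence [s] is [x], and the
    directed set, being finite, contains its supremum. *)

Require Import Defs.
From mathcomp Require Import all_boot all_order all_algebra.
From mathcomp Require Import all_classical all_reals all_analysis.

Set Implicit Arguments.
Unset Strict Implicit.
Unset Printing Implicit Defensive.

Import Order.TTheory.

Local Open Scope classical_set_scope.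

Lemma traceX_bigcup d (X : porderType d) (F : set (set (scott (Xinfty X)))) :
  traceX (\bigcup_(V in F) V) = \bigcup_(U in [set traceX V | V in F]) U.
Proof.
apply/seteqP; split=> x /=; first by move=> [V FV Vx]; exists (traceX V) => //; exists V.
by move=> [_ [V FV <-] Vx]; exists V.
Qed.

Lemma valuation_mu_tilde (R : realType) d (X : porderType d)
    (mu : set (alexandroff X) -> \bar R) :
  valuation mu -> valuation (mu_tilde mu).
Proof.
move=> [mu_ge0 mu0 mu_mono mu_mod]; split.
- by move=> U /open_traceX; exact: mu_ge0.
- by rewrite /mu_tilde /traceX preimage_set0.
- move=> U V /open_traceX oU /open_traceX oV UV.
  by apply: mu_mono => // x; exact: UV.
- by move=> U V /open_traceX oU /open_traceX oV; exact: mu_mod.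
Qed.

(** The trace commutes with unions and is monotone, so it sends a directed family of Scott-open sets
    to a directed family of open sets, to which the continuity of [mu] applies. *)
Lemma scott_continuous_mu_tilde (R : realType) d (X : porderType d)
    (mu : set (alexandroff X) -> \bar R) :
  scott_continuous mu -> scott_continuous (mu_tilde mu).
Proof.
move=> mu_cont F oF [[V0 FV0] dF].
rewrite /mu_tilde traceX_bigcup mu_cont.
- by rewrite image_comp.
- by move=> _ [V FV <-]; exact: open_traceX (oF _ FV).
- split; first by exists (traceX V0), V0.
  move=> _ _ [U FU <-] [V FV <-].
  have [W [FW UW VW]] := dF U V FU FV.
  by exists (traceX W); split; [exists W | move=> x; exact: UW | move=> x; exact: VW].
Qed.

Lemma directed_finite_greatest d (T : porderType d) (D : set T) :
  directed <=%O D -> finite_set D -> exists2 m, D m & ubound D m.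
Proof.
move=> [[x0 Dx0] dD] /finite_seqP[s Ds].
have [m Dm mub] : exists2 m, D m & forall x, x \in s -> (x <= m)%O.
  (* Only the inclusion of [s] in [D] is kept, so that it passes to tails; [x0] serves the empty
     list. *)
  have : forall x, x \in s -> D x by rewrite Ds.
  elim: s {Ds} => [_|a s IHs sD]; first by exists x0.
  have [x xs|m Dm mub] := IHs; first by apply: sD; rewrite inE xs orbT.
  have [z [Dz az mz]] := dD a m (sD a (mem_head a s)) Dm.
  exists z => // x; rewrite inE => /predU1P[->//|/mub xm].
  exact: le_trans xm mz.
by exists m => // x; rewrite Ds => /mub.
Qed.

Lemma closed_setD_principal_filter d (X : porderType d) (C : set (alexandroff X))
    (a : X) : closed C -> closed (C `\` [set x : alexandroff X | (a <= (x : X))%O]).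
Proof.
move=> cC; apply: closedI => //; rewrite closedC open_alexandroffE.
by move=> x y /= ax xy; exact: le_trans ax xy.
Qed.

(** If [a] and [b] had no common upper bound in [C], then [C] would be the union of two proper
    closed subsets, obtained by removing the points above [a] and those above [b]. A common upper
    bound puts both in one principal ideal, which is a chain. *)
Lemma irreducible_closed_total d (X : porderType d) (C : set (alexandroff X)) :
  prefix_order X -> closed C -> irreducible C -> total_on (C : set X) <=%O.
Proof.
move=> prefixX cC [_ irrC] a b Ca Cb.
have [c [Cc ac bc]] : exists c : X, [/\ C c, (a <= c)%O & (b <= c)%O].
  apply: contrapT => nub; apply: irrC.
  exists (C `\` [set x : alexandroff X | (a <= (x : X))%O]).
  exists (C `\` [set x : alexandroff X | (b <= (x : X))%O]).
  split; try exact: closed_setD_principal_filter.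
  - by split=> [|/(_ a Ca)[_]]; [exact: subDsetl | apply => /=].
  - by split=> [|/(_ b Cb)[_]]; [exact: subDsetl | apply => /=].
  - apply/seteqP; split=> [x Cx|x [[]|[]]//].
    have [ax|nax] := pselect (a <= (x : X))%O; last by left.
    by right; split=> // bx; apply: nub; exists x.
exact: prefixX ac bc.
Qed.

Lemma Base_total d (X : porderType d) (p : Xinfty X) (x y : X) :
  prefix_order X -> (Base x <= p)%O -> (Base y <= p)%O ->
  (x <= y)%O \/ (y <= x)%O.
Proof.
move=> prefixX; case: p => [z|C nC]; first exact: prefixX.
move=> /asboolP Cx /asboolP Cy; have [cC iC _] := nC.
exact: irreducible_closed_total prefixX cC iC x y Cx Cy.
Qed.

Lemma Infty_maximal d (X : porderType d) (C : set (alexandroff X))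
    (nC : non_sober C) (p : Xinfty X) : (Infty C nC <= p)%O -> Infty C nC = p.
Proof.
case: p => [//|C' nC'] /asboolP CC'; subst C'.
by rewrite (Prop_irrelevance nC nC').
Qed.

Lemma finite_principal_ideal_Base d (X : porderType d) (x : X) :
  simple_prefix_order X -> finite_set (principal_ideal (Base x : Xinfty X)).
Proof.
move=> /(_ x) finx.
apply: (@sub_finite_set _ _ (Base @` principal_ideal x)); last exact: finite_image.
by move=> [y|//] yx; exists y.
Qed.

Lemma scott_open_principal_filter_Base d (X : porderType d) (x : X) :
  prefix_order X -> simple_prefix_order X ->
  scott_open [set p : Xinfty X | (Base x <= p)%O].
Proof.
move=> prefixX simpleX; split=> [p q xp pq|D s dD [Ds s_least] xs].
  exact: le_trans xp pq.
apply: contrapT => nDx.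
have Dx : ubound D (Base x).
  move=> [y|C nC] Dp.
    have [xy|//] := Base_total prefixX xs (Ds _ Dp).
    by case: nDx; exists (Base y).
  (* A point at infinity in [D] lies below [s], so by maximality it is [s], which is above [x]. *)
  by case: nDx; exists (Infty C nC); split=> //=; rewrite (Infty_maximal (Ds _ Dp)).
have sx : s = Base x by apply/le_anti/andP; split=> //; exact: s_least.
have finD : finite_set D.
  exact: sub_finite_set Dx (finite_principal_ideal_Base x simpleX).
have [m Dm mub] := directed_finite_greatest dD finD.
by apply: nDx; exists m; split=> //=; rewrite -sx; exact: s_least.
Qed.

Lemma ex_Base_le d (X : porderType d) (p : Xinfty X) :
  exists x : X, (Base x <= p)%O.
Proof.
case: p => [x|C nC]; first by exists x.
by have [_ [[x Cx] _] _] := nC; exists x; exact/asboolP.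
Qed.

(** Choose [x] in [X] below [p]. The trace of the upper set of [Base x] is the least open set
    containing [x], so monotonicity bounds its value by that of any open neighbourhood of [x] of
    finite value. *)
Lemma locally_finite_mu_tilde (R : realType) d (X : porderType d)
    (mu : set (alexandroff X) -> \bar R) :
  prefix_order X -> simple_prefix_order X ->
  valuation mu -> locally_finite mu -> locally_finite (mu_tilde mu).
Proof.
move=> prefixX simpleX [_ _ mu_mono _] mu_fin p.
have [x xp] := ex_Base_le p.
have oV := scott_open_principal_filter_Base x prefixX simpleX.
exists [set q : Xinfty X | (Base x <= q)%O]; split; first by split.
have [U [[oU Ux] Ufin]] := mu_fin x.
apply: le_lt_trans Ufin; apply: mu_mono => //; first exact: open_traceX.
by move=> y xy; exact: oU Ux xy.
Qed.

Theorem theorem38 (R : realType) (d : Order.disp_t) (X : porderType d)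
    (mu : set (alexandroff X) -> \bar R)
    (prefixX : prefix_order X)
    (mu_valuation : valuation mu)
    (mu_continuous : scott_continuous mu)
    (mu_locally_finite : locally_finite mu) :
  (valuation (mu_tilde mu) /\ scott_continuous (mu_tilde mu)) /\
  (simple_prefix_order X -> locally_finite (mu_tilde mu)).
Proof.
split; last by move=> simpleX; exact: locally_finite_mu_tilde.
by split; [exact: valuation_mu_tilde | exact: scott_continuous_mu_tilde].
Qed.
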